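(* Let $(D,X)$ be a Dyer system and let $\{P_i\}_{i\in I}$ be a family (indexed by an arbitrary set $I$) of parabolic subgroups of $D$. Then $\bigcap_{i\in I}P_i$ is a parabolic subgroup of $D$.
   Context: A Dyer graph is a finite simplicial graph $\Gamma$ with vertex set $V(\Gamma)$ and edge set $E(\Gamma)$, together with a vertex labelling $f\colon V(\Gamma)\to\mathbb{N}_{\geq 2}\cup\{\infty\}$ and an edge labelling $m\colon E(\Gamma)\to\mathbb{N}_{>2}\cup\{\infty\}$ such that for every edge $\{u,v\}\in E(\Gamma)$, if $f(v)\geq 3$ (including $f(v)=\infty$), then $m(u,v)=\infty$. The labelling $m$ is extended to all pairs of distinct vertices by $m(u,v)=2$ if $\{u,v\}\notin E(\Gamma)$. The associated Dyer group is $$D(\Gamma)=\langle V(\Gamma)\mid v^{f(v)}=1 \text{ for all } v \text{ with } f(v)<\infty,\ \underbrace{uvu\cdots}_{m(u,v)\text{ terms}}=\underbrace{vuv\cdots}_{m(u,v)\text{ terms}}\text{ for all } \{u,v\}\text{ with } m(u,v)\neq\infty\rangle.$$ A Dyer system is a pair $(D,X)$ where $D$ is a group and $X\subseteq D$ is a generating set such that there exist a Dyer graph $\Gamma$ and a group isomorphism $D(\Gamma)\to D$ mapping $V(\Gamma)$ bijectively onto $X$. For $Y\subseteq X$, $D_Y$ denotes the subgroup of $D$ generated by $Y$. A parabolic subgroup of $D$ (with respect to $X$) is a subgroup of the form $gD_Yg^{-1}$ with $g\in D$ and $Y\subseteq X$. The intersection of the empty family is $D$. *)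

(* Defs.v *)
From HB Require Import structures.
From mathcomp Require Import all_boot.
From mathcomp Require Import boolp classical_sets functions.

Set Implicit Arguments.
Unset Strict Implicit.
Unset Printing Implicit Defensive.

Local Open Scope classical_set_scope.
Local Open Scope group_scope.

(* A letter (x, false) stands for x and (x, true) for its formal inverse. *)
Definition gword (X : choiceType) := seq (X * bool).

Definition inv_gword (X : choiceType) (w : gword X) : gword X :=
  rev [seq (l.1, ~~ l.2) | l <- w].

(* The smallest congruence on words that contains the free cancellations and
   the pairs (w1, w2) with R w1 w2; the latter are the defining relations
   w1 = w2 of the presentation < X | R >. *)
Inductive pres_eq (X : choiceType) (R : gword X -> gword X -> Prop) :
    gword X -> gword X -> Prop :=
| PresRel w1 w2 : R w1 w2 -> pres_eq R w1 w2
| PresCancel x b : pres_eq R [:: (x, b); (x, ~~ b)] [::]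
| PresRefl w : pres_eq R w w
| PresSym w1 w2 : pres_eq R w1 w2 -> pres_eq R w2 w1
| PresTrans w1 w2 w3 : pres_eq R w1 w2 -> pres_eq R w2 w3 -> pres_eq R w1 w3
| PresCat w1 w1' w2 w2' : pres_eq R w1 w1' -> pres_eq R w2 w2' ->
    pres_eq R (w1 ++ w2) (w1' ++ w2').

Section PresentedGroup.
Context (X : choiceType) (R : gword X -> gword X -> Prop).

Definition pres_eqb : rel (gword X) := fun w1 w2 => `[< pres_eq R w1 w2 >].

Lemma pres_eqb_refl : reflexive pres_eqb.
Proof. by move=> w; apply/asboolP; exact: PresRefl. Qed.

Lemma pres_eqb_sym : symmetric pres_eqb.
Proof. by move=> w1 w2; apply/asboolP/asboolP => /PresSym. Qed.

Lemma pres_eqb_trans : transitive pres_eqb.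
Proof. by move=> w2 w1 w3 /asboolP h /asboolP /(PresTrans h) ?; apply/asboolP. Qed.

Canonical pres_equiv :=
  EquivRel pres_eqb pres_eqb_refl pres_eqb_sym pres_eqb_trans.

Definition presented_group := {eq_quot pres_equiv}%qT.

HB.instance Definition _ := Choice.on presented_group.
HB.instance Definition _ := EqQuotient.on presented_group.

Definition pres_class (w : gword X) : presented_group :=
  (\pi_presented_group w)%qT.

Lemma pres_classP (w1 w2 : gword X) :
  pres_class w1 = pres_class w2 <-> pres_eq R w1 w2.
Proof. by split=> [/eqmodP/asboolP|h]; last by apply/eqmodP/asboolP. Qed.

Lemma repr_pres_class (w : gword X) : pres_eq R (repr (pres_class w)) w.
Proof. by apply/pres_classP; rewrite /pres_class reprK. Qed.

Lemma pres_class_repr (x : presented_group) : pres_class (repr x) = x.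
Proof. exact: reprK. Qed.

Definition pres_one : presented_group := pres_class [::].
Definition pres_mul (x y : presented_group) : presented_group :=
  pres_class (repr x ++ repr y).
Definition pres_inv (x : presented_group) : presented_group :=
  pres_class (inv_gword (repr x)).

Lemma pres_mulA : associative pres_mul.
Proof.
move=> x y z; apply/pres_classP.
apply: (PresTrans (PresCat (PresRefl _ _) (repr_pres_class _))).
rewrite catA; apply: PresSym.
exact: PresCat (repr_pres_class _) (PresRefl _ _).
Qed.

Lemma pres_mul1g : left_id pres_one pres_mul.
Proof.
move=> x; rewrite -[RHS]pres_class_repr; apply/pres_classP.
exact: PresCat (repr_pres_class [::]) (PresRefl _ _).
Qed.

Lemma pres_mulg1 : right_id pres_one pres_mul.
Proof.
move=> x; rewrite -[RHS]pres_class_repr; apply/pres_classP.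
rewrite -[X in pres_eq _ _ X]cats0.
exact: PresCat (PresRefl _ _) (repr_pres_class [::]).
Qed.

Lemma inv_gwordK : involutive (@inv_gword X).
Proof.
move=> w; rewrite /inv_gword map_rev revK -map_comp map_id_in // => l _ /=.
by rewrite negbK; case: l.
Qed.

Lemma cat_inv_gword (w : gword X) : pres_eq R (w ++ inv_gword w) [::].
Proof.
elim: w => [|[x b] w ih]; first exact: PresRefl.
rewrite /inv_gword map_cons rev_cons -cats1 -/(inv_gword w) /= catA -cat1s.
apply: (PresTrans (PresCat (PresRefl _ [:: (x, b)])
                           (PresCat ih (PresRefl _ _)))).
exact: PresCancel.
Qed.

Lemma pres_mulVg : left_inverse pres_one pres_inv pres_mul.
Proof.
move=> x; apply/pres_classP.
apply: (PresTrans (PresCat (repr_pres_class _) (PresRefl _ _))).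
by rewrite -[X in _ ++ X]inv_gwordK; exact: cat_inv_gword.
Qed.

Lemma pres_mulgV : right_inverse pres_one pres_inv pres_mul.
Proof.
move=> x; apply/pres_classP.
apply: (PresTrans (PresCat (PresRefl _ _) (repr_pres_class _))).
exact: cat_inv_gword.
Qed.

HB.instance Definition _ := isGroup.Build presented_group
  pres_mulA pres_mul1g pres_mulg1 pres_mulVg pres_mulgV.

Definition pres_gen (x : X) : presented_group := pres_class [:: (x, false)].

End PresentedGroup.

(* A label is an element of N or infinity, the latter encoded as None. *)
Definition label := option nat.

Definition label_ge (k : nat) (l : label) : bool :=
  if l is Some n then k <= n else true.

(* The values of elab on pairs that are not edges are irrelevant. *)
Record dyer_graph := DyerGraph {
  vertex :> finType;
  adj : rel vertex;
  adj_sym : symmetric adj;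
  adj_irr : irreflexive adj;
  vlab : vertex -> label;
  elab : vertex -> vertex -> label;
  elab_sym : forall u v, adj u v -> elab u v = elab v u;
  vlab_ge2 : forall v, label_ge 2 (vlab v);
  elab_gt2 : forall u v, adj u v -> label_ge 3 (elab u v);
  elab_infty : forall u v, adj u v -> label_ge 3 (vlab v) -> elab u v = None
}.

Definition mlab (Gamma : dyer_graph) (u v : Gamma) : label :=
  if adj u v then elab u v else Some 2.

(* The word u v u ... with n letters. *)
Fixpoint alt_gword (X : choiceType) (n : nat) (u v : X) : gword X :=
  if n is n'.+1 then (u, false) :: alt_gword n' v u else [::].

Inductive dyer_rel (Gamma : dyer_graph) : gword Gamma -> gword Gamma -> Prop :=
| DyerPower (v : Gamma) n : vlab v = Some n ->
    dyer_rel (nseq n (v, false)) [::]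
| DyerBraid (u v : Gamma) n : u != v -> mlab u v = Some n ->
    dyer_rel (alt_gword n u v) (alt_gword n v u).

Definition dyer_group (Gamma : dyer_graph) : groupType :=
  presented_group (@dyer_rel Gamma).

Definition dyer_gen (Gamma : dyer_graph) (v : Gamma) : dyer_group Gamma :=
  pres_gen (@dyer_rel Gamma) v.

Definition subgroup_gen (G : groupType) (Y : set G) : set G :=
  smallest [set H : set G | group_closed [in H]] Y.

Definition dyer_system (D : groupType) (X : set D) : Prop :=
  subgroup_gen X = [set: D] /\
  exists (Gamma : dyer_graph) (phi : dyer_group Gamma -> D),
    [/\ {morph phi : x y / x * y}, bijective phi &
        set_bij [set: Gamma] X (fun v => phi (dyer_gen v))].

Definition parabolic (D : groupType) (X P : set D) : Prop :=
  exists (g : D) (Y : set D),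
    Y `<=` X /\ P = [set g * h * g^-1 | h in subgroup_gen Y].

(* Main.v *)
(* To each conjugate [t] of a cyclic subgroup [<x>], [x] in [X], attach the
   component at [t] of a crossed homomorphism [N] from [D] to the product of
   all such [t], normalised by [N x <x> = x] and [N x t = 1] for [t <> <x>]. It
   generalises the inversion sets of a Coxeter group, and it exists because it
   respects the Dyer relations: the reflections along the two sides of a braid
   relation are the same, in opposite orders.
   Let [d] have minimal syllabic length in [D_Y d D_Z]. Then [N d t = 1] for
   [t] contained in [D_Y], and comparing [N (g d)] with [N (d h)] when
   [g d = d h] yields, as in Kilmoyer's theorem for Coxeter groups, that
   [D_Y] meets [d D_Z d^-1] in [D_K] with [K] the set of the [x] in [Y] lying
   in [d D_Z d^-1]. For an arbitrary family, take a parabolic [g D_Y g^-1]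
   containing the intersection with [Y] of minimal cardinality: its
   intersection with any member is [g' D_K g'^-1] with [K] inside [Y], so
   [K = Y], and the intersection is [g D_Y g^-1] itself. *)

Require Import Defs.
From mathcomp Require Import all_boot.
From mathcomp Require Import boolp classical_sets functions.

Local Open Scope classical_set_scope.

(** * Generated subgroups, their conjugates, and cyclic subgroups *)

Section SubgroupGen.
Local Open Scope group_scope.
Context {D : groupType}.
Implicit Types (x y g h : D) (Y Z S : set D).

Lemma group_closedP S : group_closed [in S] <->
  S 1 /\ forall x y, S x -> S y -> S (x * y^-1).
Proof.
split=> [[S1 Sdiv]|[S1 Sdiv]].
  split=> [|x y Sx Sy]; first by move: S1; rewrite inE.
  by have := Sdiv x y; rewrite !inE; exact.
by split=> [|x y]; rewrite !inE //; exact: Sdiv.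
Qed.

Lemma subgroup_gen_ind S Y : S 1 ->
  (forall x y, S x -> S y -> S (x * y^-1)) -> Y `<=` S -> subgroup_gen Y `<=` S.
Proof. by move=> S1 Sdiv YS; apply: smallest_sub => //; exact/group_closedP. Qed.

Lemma subgroup_gen_gen Y : Y `<=` subgroup_gen Y.
Proof. exact: sub_gen_smallest. Qed.

Lemma subgroup_gen1 Y : subgroup_gen Y 1.
Proof. by move=> S [/group_closedP[]]. Qed.

Lemma subgroup_genF Y x y :
  subgroup_gen Y x -> subgroup_gen Y y -> subgroup_gen Y (x * y^-1).
Proof.
move=> Yx Yy S [Sgrp YS]; have [_ Sdiv] := (group_closedP S).1 Sgrp.
by apply: Sdiv; [exact: Yx | exact: Yy].
Qed.

Lemma subgroup_genV Y x : subgroup_gen Y x -> subgroup_gen Y x^-1.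
Proof. by move=> /(subgroup_genF _ _ _ (subgroup_gen1 Y)); rewrite mul1g. Qed.

Lemma subgroup_genM Y x y :
  subgroup_gen Y x -> subgroup_gen Y y -> subgroup_gen Y (x * y).
Proof. by move=> Yx /subgroup_genV/(subgroup_genF _ _ _ Yx); rewrite invgK. Qed.

Lemma subgroup_gen_sub Y Z :
  Y `<=` subgroup_gen Z -> subgroup_gen Y `<=` subgroup_gen Z.
Proof.
by apply: subgroup_gen_ind; [exact: subgroup_gen1 | exact: subgroup_genF].
Qed.

Lemma subgroup_genMl Y x y :
  subgroup_gen Y x -> subgroup_gen Y (x * y) <-> subgroup_gen Y y.
Proof.
move=> Yx; split=> [/(subgroup_genM _ _ _ (subgroup_genV _ _ Yx))|].
  by rewrite mulKg.
exact: subgroup_genM.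
Qed.

Definition conj_set g S : set D := [set g * h * g^-1 | h in S].

Lemma conj_setP g S x : conj_set g S x <-> S (g^-1 * x * g).
Proof.
split=> [[h Sh <-]|Sx]; first by rewrite !mulgA mulVg mul1g mulgVK.
by exists (g^-1 * x * g) => //; rewrite !mulgA mulgV mul1g mulgK.
Qed.

Lemma conj_set1 S : conj_set 1 S = S.
Proof.
by apply/seteqP; split=> x; rewrite conj_setP invg1 mul1g mulg1.
Qed.

Lemma conj_setM g h S : conj_set (g * h) S = conj_set g (conj_set h S).
Proof.
by apply/seteqP; split=> x; rewrite !conj_setP invgM !mulgA.
Qed.

Lemma conj_setK g S : conj_set g^-1 (conj_set g S) = S.
Proof. by rewrite -conj_setM mulVg conj_set1. Qed.

Lemma conj_setKV g S : conj_set g (conj_set g^-1 S) = S.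
Proof. by rewrite -conj_setM mulgV conj_set1. Qed.

Lemma conj_setI g S1 S2 :
  conj_set g (S1 `&` S2) = conj_set g S1 `&` conj_set g S2.
Proof.
by apply/seteqP; split=> x /=; rewrite !conj_setP.
Qed.

Lemma conj_set_eq g S1 S2 : conj_set g^-1 S1 = S2 <-> S1 = conj_set g S2.
Proof. by split=> [<-|->]; rewrite ?conj_setKV ?conj_setK. Qed.

Lemma sub_conj_subgroup_gen g Y :
  subgroup_gen (conj_set g Y) `<=` conj_set g (subgroup_gen Y).
Proof.
apply: subgroup_gen_ind => [|x y|x].
- by rewrite conj_setP mulg1 mulVg; exact: subgroup_gen1.
- rewrite !conj_setP => Yx Yy; have := subgroup_genF _ _ _ Yx Yy.
  by rewrite !invgM invgK !mulgA mulgK.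
- by rewrite !conj_setP; exact: subgroup_gen_gen.
Qed.

Lemma conj_subgroup_gen g Y :
  conj_set g (subgroup_gen Y) = subgroup_gen (conj_set g Y).
Proof.
apply/seteqP; split; last exact: sub_conj_subgroup_gen.
move=> x /conj_setP Yx.
rewrite -(conj_setKV g (subgroup_gen _)) conj_setP.
by apply: sub_conj_subgroup_gen; rewrite conj_setK.
Qed.

Lemma conj_subgroup_gen_id Y g :
  subgroup_gen Y g -> conj_set g (subgroup_gen Y) = subgroup_gen Y.
Proof.
move=> Yg; apply/seteqP; split=> x.
  rewrite conj_setP => Yx.
  by have := subgroup_genF _ _ _ (subgroup_genM _ _ _ Yg Yx) Yg;
    rewrite !mulgA mulgV mul1g mulgK.
move=> Yx; rewrite conj_setP.
by apply: subgroup_genM => //; apply: subgroup_genM => //; exact: subgroup_genV.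
Qed.

Definition cyc x : set D := subgroup_gen [set x].

Lemma mem_cyc x : cyc x x.
Proof. exact: subgroup_gen_gen. Qed.

Lemma cyc_sub Y x : subgroup_gen Y x -> cyc x `<=` subgroup_gen Y.
Proof. by move=> Yx; apply: subgroup_gen_sub => _ ->. Qed.

Lemma conj_cyc g x : conj_set g (cyc x) = cyc (g * x * g^-1).
Proof. by rewrite /cyc conj_subgroup_gen /conj_set image_set1. Qed.

Lemma cyc_commute x y z : cyc x y -> cyc x z -> commute y z.
Proof.
have cycC u v : commute u v -> forall w, cyc v w -> commute u w.
  move=> uv; apply: subgroup_gen_ind => [|a b ua ub|_ -> //]; first exact: commute1.
  by apply: commuteM => //; exact: commuteV.
move=> xy xz; apply: (cycC y x) xz.
exact/commute_sym/(cycC x x).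
Qed.

Lemma conj_cyc_id x s : cyc x s -> conj_set s (cyc x) = cyc x.
Proof. exact: conj_subgroup_gen_id. Qed.

End SubgroupGen.

(** * Crossed homomorphisms and intersections of parabolic subgroups *)

Section Cocycle.
Local Open Scope group_scope.
Context {D : groupType} (X : set D).
Implicit Types (x g h d : D) (Y Z t : set D).

(** Components are indexed by all subsets [t] of [D] and valued in [D] rather than in [t], which
    avoids dependent types; [D] acts by conjugating index and value together. *)
Definition wall_cocycle (N : D -> set D -> D) :=
  (forall g h t, N (g * h) t = N g t * (g * N h (conj_set g^-1 t) * g^-1)) /\
  (forall x, X x -> forall t, N x t = if `[< t = cyc x >] then x else 1).

Context (N : D -> set D -> D) (hN : wall_cocycle N).

Lemma cocycleM g h t :
  N (g * h) t = N g t * (g * N h (conj_set g^-1 t) * g^-1).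
Proof. exact: hN.1. Qed.

Lemma cocycle1 t : N 1 t = 1.
Proof.
have := cocycleM 1 1 t; rewrite invg1 !mulg1 conj_set1 !mul1g => /esym.
by rewrite -[RHS]mulg1 => /mulgI.
Qed.

(** The [s] obeying the formula form a subgroup: conjugation by elements of [cyc x] fixes [cyc x],
    and these elements commute. *)
Lemma cocycle_cyc x s t : X x -> cyc x s ->
  N s t = if `[< t = cyc x >] then s else 1.
Proof.
move=> Xx; set S := [set s | cyc x s /\
  forall t, N s t = if `[< t = cyc x >] then s else 1].
suff cycS : cyc x `<=` S by move=> /cycS[_]; exact.
apply: subgroup_gen_ind => [|a b [xa Na] [xb Nb]|_ ->].
- split=> [|u]; first exact: subgroup_gen1.
  by rewrite cocycle1; case: asboolP.
- split=> [|u]; first exact: subgroup_genF.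
  (* The component of [b^-1] is solved for from that of [b * b^-1 = 1] at [conj_set b v]. *)
  have NV v : N b^-1 v = if `[< v = cyc x >] then b^-1 else 1.
    have := cocycleM b b^-1 (conj_set b v).
    rewrite mulgV cocycle1 conj_setK Nb.
    have -> : `[< conj_set b v = cyc x >] = `[< v = cyc x >].
      apply: asbool_equiv_eq; rewrite -{1}(invgK b) conj_set_eq.
      by rewrite (conj_cyc_id _ _ (subgroup_genV _ _ xb)).
    case: asboolP => _.
      move=> /esym/mulg1_eq; rewrite -[LHS]mul1g => /mulIg/esym.
      by move=> /mulg1_eq.
    rewrite mul1g => /esym/divg1_eq; rewrite -[RHS]mulg1.
    exact: mulgI.
  rewrite cocycleM Na NV.
  have -> : `[< conj_set a^-1 u = cyc x >] = `[< u = cyc x >].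
    by apply: asbool_equiv_eq; rewrite conj_set_eq conj_cyc_id.
  case: asboolP => _; last by rewrite mulg1 mulgV mulg1.
  have ab : commute a b^-1 by apply: commuteV; exact: cyc_commute xa xb.
  by rewrite ab mulgK.
- by split; [exact: mem_cyc | exact: hN.2].
Qed.

(* Products of [n] syllables, a syllable being any element, possibly 1, of a
   cyclic subgroup [cyc x] with [x] in [Y]. *)
Fixpoint syllabic Y (n : nat) : set D :=
  if n is n'.+1 then
    [set g | exists x s h, [/\ Y x, cyc x s, syllabic Y n' h & g = s * h]]
  else [set 1].

Lemma syllabicM Y m n g h :
  syllabic Y m g -> syllabic Y n h -> syllabic Y (m + n) (g * h).
Proof.
elim: m g => [|m IHm] g /=; first by move=> -> Yh; rewrite mul1g.
move=> [x [s [g' [Yx xs Yg' ->]]]] Yh.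
by exists x, s, (g' * h); split => //; [exact: IHm | rewrite mulgA].
Qed.

Lemma syllabic_syllable Y x s : Y x -> cyc x s -> syllabic Y 1 s.
Proof. by move=> Yx xs; exists x, s, 1; split => //; rewrite mulg1. Qed.

Lemma syllabicV Y n g : syllabic Y n g -> syllabic Y n g^-1.
Proof.
elim: n g => [|n IHn] g; first by move=> /= ->; rewrite invg1.
move=> [x [s [h [Yx xs Yh ->]]]]; rewrite invgM -[n.+1]addn1.
apply: syllabicM; first exact: IHn.
by apply: (syllabic_syllable _ x) => //; exact: subgroup_genV.
Qed.

Lemma syllabicP Y g : subgroup_gen Y g <-> exists n, syllabic Y n g.
Proof.
split=> [|[n]].
  move: g; apply: subgroup_gen_ind => [|g h [m Yg] [n Yh]|g Yg].
  - by exists 0.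
  - by exists (m + n)%N; apply: syllabicM => //; exact: syllabicV.
  - by exists 1%N; apply: (syllabic_syllable _ g) => //; exact: mem_cyc.
elim: n g => [|n IHn] g /=; first by move=> ->; exact: subgroup_gen1.
move=> [x [s [h [Yx xs /IHn Yh ->]]]]; apply: subgroup_genM => //.
by apply: cyc_sub xs; exact: subgroup_gen_gen.
Qed.

(** Expanding [N g t] by the cocycle rule gives one factor per syllable; a nontrivial one comes from
    a syllable whose cyclic subgroup, conjugated by the preceding prefix, is [t]. *)
Lemma syllabic_split Y n g t : Y `<=` X -> syllabic Y n g -> N g t <> 1 ->
  exists m k g1 x s g2,
    [/\ n = (m + k.+1)%N, g = g1 * (s * g2), t = conj_set g1 (cyc x) &
    [/\ syllabic Y m g1, Y x, cyc x s & syllabic Y k g2]].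
Proof.
move=> YX; elim: n g t => [|n IHn] g t /=; first by move=> ->; rewrite cocycle1.
move=> [x [s [h [Yx xs Yh ->]]]].
rewrite cocycleM (cocycle_cyc _ _ _ (YX _ Yx) xs).
case: asboolP => [-> _|_].
  by exists 0, n, 1, x, s, h; rewrite mul1g conj_set1.
rewrite mul1g => Nh; have {}Nh : N h (conj_set s^-1 t) <> 1.
  by move=> Nh1; apply: Nh; rewrite Nh1 mulg1 mulgV.
have [m [k [g1 [y [s' [g2 [-> -> /conj_set_eq -> [Yg1 Yy ys' Yg2]]]]]]]] :=
  IHn _ _ Yh Nh.
exists m.+1, k, (s * g1), y, s', g2; split; rewrite ?conj_setM ?mulgA //.
by split => //; exists x, s, g1.
Qed.

Definition short_coset_rep Y Z d := exists2 n, syllabic X n d &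
  forall m a b, subgroup_gen Y a -> subgroup_gen Z b ->
    syllabic X m (a * d * b) -> n <= m.

Lemma short_coset_rep_exists Y Z g : subgroup_gen X = [set: D] ->
  exists a d b, [/\ subgroup_gen Y a, subgroup_gen Z b, g = a * d * b &
    short_coset_rep Y Z d].
Proof.
move=> genX.
pose good n := `[< exists a b, [/\ subgroup_gen Y a, subgroup_gen Z b &
  syllabic X n (a * g * b)] >].
have ex_good : exists n, good n.
  have /syllabicP[n Xg] : subgroup_gen X g by rewrite genX.
  exists n; apply/asboolP; exists 1, 1.
  by rewrite mul1g mulg1; split => //; exact: subgroup_gen1.
case: (ex_minnP ex_good) => n /asboolP[a [b [Ya Zb Xd]]] n_min.
exists a^-1, (a * g * b), b^-1; split; try exact: subgroup_genV.
  by rewrite !mulgA mulVg mul1g mulgK.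
exists n => // m a' b' Ya' Zb' Xm; apply: n_min; apply/asboolP.
exists (a' * a), (b * b'); split; try exact: subgroup_genM.
by rewrite !mulgA in Xm *.
Qed.

(** A deletion argument: otherwise [d = g1 * (s * g2)] with [g1 * s^-1 * g1^-1] in [t], hence in
    [subgroup_gen Y]. Multiplying by it on the left deletes [s] and contradicts minimality. *)
Lemma cocycle_short_coset_rep Y Z d t :
  short_coset_rep Y Z d -> t `<=` subgroup_gen Y -> N d t = 1.
Proof.
move=> [n Xd n_min] tY; apply: contrapT => Nd.
have [m [k [g1 [x [s [g2 [def_n def_d def_t [Xg1 _ xs Xg2]]]]]]]] :=
  syllabic_split _ _ _ _ (@subset_refl _ X) Xd Nd.
have Ys : subgroup_gen Y (g1 * s^-1 * g1^-1).
  by apply: tY; rewrite def_t; exists s^-1 => //; exact: subgroup_genV.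
have := n_min (m + k)%N _ 1 Ys (subgroup_gen1 _).
rewrite def_n addnS ltnn mulg1 def_d !mulgA mulgVK mulgVK => n_lt.
by have /n_lt: syllabic X (m + k) (g1 * g2) by exact: syllabicM.
Qed.

(* The first syllable [s], in [cyc x], of a shortest expression of [g] over
   [Y] makes the cocycle of [g * d = d * h] nontrivial at [cyc x]. This
   component cannot come from [d], hence comes from [h]. *)
Lemma subgroup_gen_cap_conj Y Z d : Y `<=` X -> Z `<=` X ->
  short_coset_rep Y Z d ->
  subgroup_gen Y `&` conj_set d (subgroup_gen Z) =
  subgroup_gen (Y `&` conj_set d (subgroup_gen Z)).
Proof.
move=> YX ZX d_short; set K := Y `&` _; apply/seteqP; split; last first.
  apply: subgroup_gen_ind => [|x y [Yx dx] [Yy dy]|x [Yx dx]].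
  - split; first exact: subgroup_gen1.
    by rewrite conj_setP mulg1 mulVg; exact: subgroup_gen1.
  - split; first exact: subgroup_genF.
    by rewrite conj_subgroup_gen in dx dy *; exact: subgroup_genF.
  - by split => //; exact: subgroup_gen_gen.
move=> g [/syllabicP[n]].
have [m] := ubnP n; elim: m n g => // m IHm [|n] g lt_nm /=.
  by move=> -> _; exact: subgroup_gen1.
move=> [x [s [g' [Yx xs Yg' def_g]]]] dg.
have Yg : subgroup_gen Y g.
  by apply/syllabicP; exists n.+1; exists x, s, g'.
have cycY : cyc x `<=` subgroup_gen Y by apply: cyc_sub; exact: subgroup_gen_gen.
have [s1|s_neq1] := pselect (s = 1).
  by apply: (IHm n); rewrite // def_g s1 mul1g.
(* If [g'] also contributes at [cyc x], then [s] can be carried past the prefix [g1] and merged into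
   the syllable [s'], so [g] has an expression with one syllable fewer. *)
have [Ng'|Ng'] := pselect (N g' (cyc x) = 1); last first.
  have [k [l [g1 [y [s' [g2 [def_n def_g' def_x [Yg1 Yy ys' Yg2]]]]]]]] :=
    syllabic_split _ _ _ _ YX Yg' Ng'.
  apply: (IHm n) => //; rewrite def_n.
  have -> : g = g1 * ((g1^-1 * s * g1 * s') * g2).
    by rewrite def_g def_g' !mulgA mulgV mul1g.
  apply: syllabicM => //; exists y, (g1^-1 * s * g1 * s'), g2; split => //.
  by apply: subgroup_genM ys'; apply/conj_setP; rewrite -def_x.
have Ng : N g (cyc x) = s.
  rewrite def_g cocycleM (cocycle_cyc _ _ _ (YX _ Yx) xs) conj_cyc_id; last first.
    exact: subgroup_genV.
  by rewrite Ng' mulg1 mulgV mulg1; case: asboolP.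
case: (dg) => h Zh def_dhd.
have gd : g * d = d * h by rewrite -def_dhd mulgVK.
(* Here [d] contributes at the conjugate of [cyc x] by [g^-1], which still lies in
   [subgroup_gen Y]. *)
have Ngd : N (g * d) (cyc x) = s.
  rewrite cocycleM Ng (cocycle_short_coset_rep _ _ _ _ d_short).
    by rewrite mulg1 mulgV mulg1.
  rewrite conj_cyc; apply: cyc_sub.
  by rewrite invgK; apply: subgroup_genM => //; apply: subgroup_genM;
     [exact: subgroup_genV | exact: subgroup_gen_gen].
have [k Zkh] := (syllabicP _ _).1 Zh.
have Nh : N h (conj_set d^-1 (cyc x)) <> 1.
  move=> Nh; apply: s_neq1; rewrite -Ngd gd cocycleM Nh mulg1 mulgV mulg1.
  exact: (cocycle_short_coset_rep _ _ _ _ d_short).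
have [p [_ [h1 [y [s' [h2 [_ _ cyc_conj [Zh1 Zy _ _]]]]]]]] :=
  syllabic_split _ _ _ _ ZX Zkh Nh.
(* The conjugate of [cyc x] by [d^-1] equals that of [cyc y] by [h1], and both [y] and [h1] lie in
   [subgroup_gen Z]. *)
have dx : cyc x `<=` conj_set d (subgroup_gen Z).
  move/conj_set_eq: cyc_conj => ->; apply: image_subset.
  have genh1 : subgroup_gen Z h1 by apply/syllabicP; exists p.
  rewrite -(conj_subgroup_gen_id _ _ genh1); apply: image_subset.
  by apply: cyc_sub; exact: subgroup_gen_gen.
have Kx : K x by split => //; apply: dx; exact: mem_cyc.
rewrite def_g; apply: subgroup_genM.
  by apply: cyc_sub xs; exact: subgroup_gen_gen.
apply: (IHm n) => //; move: dg (dx _ xs).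
by rewrite def_g conj_subgroup_gen => dg dxs; exact: (subgroup_genMl _ _ _ dxs).1 dg.
Qed.

(** Writing the conjugator as [k * d * j] with [d] short, [j] is absorbed by [subgroup_gen Z], and
    [k] factors out because it normalises [subgroup_gen Y]. *)
Lemma subgroup_gen_cap_parabolic Y Q : subgroup_gen X = [set: D] ->
  Y `<=` X -> parabolic X Q -> exists k K,
  [/\ subgroup_gen Y k, K `<=` Y &
      subgroup_gen Y `&` Q = conj_set k (subgroup_gen K)].
Proof.
move=> genX YX [g [Z [ZX ->]]]; rewrite -/(conj_set _ _).
have [k [d [j [Yk Zj -> d_short]]]] := short_coset_rep_exists Y Z g genX.
exists k, (Y `&` conj_set d (subgroup_gen Z)); split => //.
rewrite -subgroup_gen_cap_conj // conj_setI (conj_subgroup_gen_id _ _ Yk).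
by rewrite !conj_setM (conj_subgroup_gen_id _ _ Zj).
Qed.

Lemma parabolic_bigcap (V : finType) (f : V -> D) (I : Type) (P : I -> set D) :
  subgroup_gen X = [set: D] -> X `<=` range f ->
  (forall i, parabolic X (P i)) -> parabolic X (\bigcap_i P i).
Proof.
move=> genX Xf hP.
(* The size of [supp Y] replaces the cardinality of [Y]; since [X] lies in the range of [f], a
   subset of [X] is determined by its [supp]. *)
pose supp Y := [set v | `[< Y (f v) >]]%SET.
pose good n := `[< exists g Y, [/\ Y `<=` X,
  \bigcap_i P i `<=` conj_set g (subgroup_gen Y) & #|supp Y| = n] >].
have ex_good : exists n, good n.
  exists #|supp X|; apply/asboolP; exists 1, X.
  by split; rewrite ?genX ?conj_set1.
case: (ex_minnP ex_good) => n /asboolP[g [Y [YX PY cardY]]] n_min.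
exists g, Y; split => //; apply/seteqP; split=> // x Yx i _.
have Qpar : parabolic X (conj_set g^-1 (P i)).
  have [h [Z [ZX ->]]] := hP i.
  by exists (g^-1 * h), Z; split => //; rewrite -/(conj_set _ _) -conj_setM.
have [k [K [Yk KY capK]]] := subgroup_gen_cap_parabolic _ _ genX YX Qpar.
have {}capK : conj_set g (subgroup_gen Y) `&` P i =
    conj_set (g * k) (subgroup_gen K).
  by rewrite conj_setM -capK conj_setI conj_setKV.
have suppKY : supp K \subset supp Y.
  by apply/fintype.subsetP => v; rewrite !inE; exact: KY.
(* The conjugate of [subgroup_gen K] by [g * k] still contains the whole intersection, so minimality
   applies to [K]. *)
have suppE : supp K = supp Y.
  apply/eqP; rewrite eqEcard suppKY cardY; apply: n_min; apply/asboolP.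
  exists (g * k), K; split => //; first exact: subset_trans YX.
  by rewrite -capK => y Py; split; [exact: PY | exact: Py].
have KE : K = Y.
  apply/seteqP; split=> // y Yy; have [v _ def_y] := Xf _ (YX _ Yy).
  have: v \in supp Y by rewrite !inE def_y.
  by rewrite -suppE !inE def_y.
have: conj_set (g * k) (subgroup_gen K) x.
  by rewrite KE conj_setM (conj_subgroup_gen_id _ _ Yk).
by rewrite -capK => -[].
Qed.

End Cocycle.

(** * The crossed homomorphism on words, and reflections along braid words *)

Section WordCocycle.
Local Open Scope group_scope.
Context {D : groupType} {V : choiceType} (gen : V -> D).
Implicit Types (w : gword V) (t : set D) (u v : V).

Definition letter_val (l : V * bool) : D :=
  if l.2 then (gen l.1)^-1 else gen l.1.

Definition word_val w : D := foldr (fun l g => letter_val l * g) 1 w.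

Lemma word_val_cat w1 w2 : word_val (w1 ++ w2) = word_val w1 * word_val w2.
Proof. by elim: w1 => [|l w1 IHw] /=; rewrite ?mul1g // IHw mulgA. Qed.

(** These values are forced by the cocycle rule and the normalisation; an inverse letter contributes
    its own value at the same cyclic subgroup. *)
Fixpoint word_cocycle w t : D :=
  if w is l :: w' then
    (if `[< t = cyc (gen l.1) >] then letter_val l else 1) *
    (letter_val l * word_cocycle w' (conj_set (letter_val l)^-1 t) *
     (letter_val l)^-1)
  else 1.

Lemma word_cocycle_cat w1 w2 t : word_cocycle (w1 ++ w2) t =
  word_cocycle w1 t *
  (word_val w1 * word_cocycle w2 (conj_set (word_val w1)^-1 t) *
   (word_val w1)^-1).
Proof.
elim: w1 t => [|l w1 IHw] t /=.
  by rewrite !mul1g invg1 conj_set1 mulg1.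
rewrite IHw invgM conj_setM -!mulgA; congr (_ * (_ * (_ * _))).
by rewrite mulKg.
Qed.

Lemma letter_val_cyc l : cyc (gen l.1) (letter_val l).
Proof.
rewrite /letter_val; case: l.2; last exact: mem_cyc.
by apply: subgroup_genV; exact: mem_cyc.
Qed.

Lemma asbool_conj_letter l t :
  `[< conj_set (letter_val l)^-1 t = cyc (gen l.1) >] =
  `[< t = cyc (gen l.1) >].
Proof.
apply: asbool_equiv_eq; rewrite conj_set_eq conj_cyc_id //.
exact: letter_val_cyc.
Qed.

Lemma word_val_pres R w1 w2 :
  (forall w w', R w w' -> word_val w = word_val w') ->
  pres_eq R w1 w2 -> word_val w1 = word_val w2.
Proof.
move=> R_val; elim=> //= [x b|w w' w'' _ -> _ -> //|w w' v v' _ ww _ vv].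
  by case: b; rewrite /letter_val /= mulg1 ?mulVg ?mulgV.
by rewrite !word_val_cat ww vv.
Qed.

(** Concatenation twists the second factor by the value of the first word, so relators must preserve
    both values and cocycles. In a free cancellation the two letters contribute inverse factors at
    the same [t]. *)
Lemma word_cocycle_pres R w1 w2 :
  (forall w w', R w w' -> word_val w = word_val w') ->
  (forall w w', R w w' -> word_cocycle w = word_cocycle w') ->
  pres_eq R w1 w2 -> word_cocycle w1 = word_cocycle w2.
Proof.
move=> R_val R_coc; elim=> //= [x b|w w' w'' _ -> _ -> //|w w' v v' ww Nw _ Nv].
  apply: funext => t /=; rewrite -[x in cyc (gen x)]/((x, b).1).
  rewrite -[x in X in _ * X]/((x, b).1) asbool_conj_letter.
  have -> : letter_val (x, ~~ b) = (letter_val (x, b))^-1.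
    by case: b => //; rewrite /letter_val /= invgK.
  case: asboolP => _; rewrite !(mulg1, mul1g, mulgV) ?invgK //.
apply: funext => t; rewrite !word_cocycle_cat Nw Nv.
by rewrite (word_val_pres _ _ _ R_val ww).
Qed.

Lemma word_val_power v n : word_val (nseq n (v, false)) = gen v ^+ n.
Proof. by elim: n => //= n ->; rewrite expgS. Qed.

Lemma word_cocycle_power v n t : word_cocycle (nseq n (v, false)) t =
  if `[< t = cyc (gen v) >] then gen v ^+ n else 1.
Proof.
elim: n t => [|n IHn] t /=; first by rewrite expg0; case: ifP.
rewrite IHn -[v in X in _ * X]/((v, false).1) asbool_conj_letter /=.
rewrite /letter_val /= expgS; case: ifP => _; last by rewrite mulg1 mulgV mulg1.
by congr (_ * _); rewrite -expgS expgSr mulgK.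
Qed.

(** For involutions, this is the [i]-th entry, counted from 0, of the reflection sequence of
    [alt_gword n u v] for any [n > i]. *)
Definition alt_reflection u v i : D :=
  word_val (alt_gword i u v) * gen (if odd i then v else u) *
  (word_val (alt_gword i u v))^-1.

Lemma alt_gword_rcons n u v : alt_gword n.+1 u v =
  alt_gword n u v ++ [:: (if odd n then v else u, false)].
Proof.
elim: n u v => [|n IHn] u v //.
have -> : alt_gword n.+2 u v = (u, false) :: alt_gword n.+1 v u by [].
by rewrite IHn /=; case: odd.
Qed.

Lemma word_cocycle_alt n u v t : word_cocycle (alt_gword n u v) t =
  \prod_(i < n) (if `[< t = cyc (alt_reflection u v i) >]
                 then alt_reflection u v i else 1).
Proof.
elim: n => [|n IHn]; first by rewrite big_ord0.
rewrite alt_gword_rcons word_cocycle_cat IHn big_ord_recr; congr (_ * _) => /=.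
rewrite mulg1 mulgV mulg1 /letter_val /=.
set g := word_val _.
have -> : `[< t = cyc (alt_reflection u v n) >] =
    `[< conj_set g^-1 t = cyc (gen (if odd n then v else u)) >].
  by apply: asbool_equiv_eq; rewrite conj_set_eq conj_cyc.
by case: ifP => _ //; rewrite mulg1 mulgV.
Qed.

Lemma prod_commute_rev (F : nat -> D) n :
  (forall i j, i < n -> j < n -> commute (F i) (F j)) ->
  \prod_(i < n) F i = \prod_(i < n) F (n.-1 - i)%N.
Proof.
elim: n => [|n IHn] FC; first by rewrite !big_ord0.
rewrite big_ord_recr big_ord_recl /= subn0 IHn; last first.
  by move=> i j lt_in lt_jn; apply: FC; exact: ltnW.
have -> : \prod_(i < n) F (n - bump 0 i)%N = \prod_(i < n) F (n.-1 - i)%N.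
  by apply: eq_bigr => i _; rewrite /bump /= add1n subnS -subn1 subnAC subn1.
apply/commute_sym/commute_prod => i _; apply: FC => //.
by rewrite ltnS (leq_trans (leq_subr _ _)) // leq_pred.
Qed.

(** At a fixed [t], every factor is 1 or a generator of the cyclic group [t]. All factors therefore
    commute, and reversing their order does not change the product. *)
Lemma word_cocycle_braid n u v :
  (forall i, i < n -> alt_reflection u v i = alt_reflection v u (n.-1 - i)) ->
  word_cocycle (alt_gword n u v) = word_cocycle (alt_gword n v u).
Proof.
move=> rev_uv; apply: funext => t; rewrite !word_cocycle_alt.
pose F i := if `[< t = cyc (alt_reflection v u i) >]
            then alt_reflection v u i else 1.
rewrite [RHS](prod_commute_rev F) => [|i j _ _].
  by apply: eq_bigr => i _; rewrite /F rev_uv.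
rewrite /F; case: asboolP => [ti|_]; last exact/commute_sym/commute1.
case: asboolP => [tj|_]; last exact: commute1.
by apply: (cyc_commute (alt_reflection v u i)); [|rewrite -ti tj]; exact: mem_cyc.
Qed.

Lemma mulg_expg_swap (x y : D) i : x * (y * x) ^+ i = (x * y) ^+ i * x.
Proof.
elim: i => [|i IHi]; first by rewrite !expg0 mulg1 mul1g.
by rewrite expgSr !mulgA IHi expgSr !mulgA.
Qed.

Lemma alt_reflection_involution u v i :
  gen u * gen u = 1 -> gen v * gen v = 1 ->
  alt_reflection u v i = (gen u * gen v) ^+ i * gen u.
Proof.
move=> u2 v2; elim: i u v u2 v2 => [|i IHi] u v u2 v2.
  by rewrite /alt_reflection /= invg1 mulg1.
have -> : alt_reflection u v i.+1 = gen u * alt_reflection v u i * (gen u)^-1.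
  by rewrite /alt_reflection /= /letter_val /= invgM !mulgA; case: odd.
rewrite IHi // mulgA mulg_expg_swap (mulg1_eq u2).
by rewrite expgSr !mulgA.
Qed.

Lemma word_val_alt_even k u v :
  word_val (alt_gword k.*2 u v) = (gen u * gen v) ^+ k.
Proof.
elim: k => //= k ->; by rewrite expgS mulgA.
Qed.

Lemma word_val_alt_odd k u v :
  word_val (alt_gword k.*2.+1 u v) = (gen u * gen v) ^+ k * gen u.
Proof. by rewrite /= word_val_alt_even -mulg_expg_swap. Qed.

(** With [c = gen u * gen v] the two sides are [c ^+ i * gen u] and [c ^- (n.-1 - i) * gen v], so
    everything reduces to [last_refl], the braid relation in dihedral form. *)
Lemma alt_reflection_braid n u v : 0 < n ->
  gen u * gen u = 1 -> gen v * gen v = 1 ->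
  word_val (alt_gword n u v) = word_val (alt_gword n v u) ->
  forall i, i < n -> alt_reflection u v i = alt_reflection v u (n.-1 - i).
Proof.
move=> n_gt0 u2 v2 braid i lt_in.
have vuV : gen v * gen u = (gen u * gen v)^-1.
  by rewrite invgM (mulg1_eq u2) (mulg1_eq v2).
(* For odd [n = 2k+1] the relation reads [c ^+ k * gen u = c ^- k * gen v]; for even [n = 2k] it
   reads [c ^+ k = c ^- k]. *)
have last_refl : (gen u * gen v) ^+ n.-1 * gen u = gen v.
  move: n_gt0 braid; rewrite -(odd_double_half n); case: (odd n) => [_|].
    rewrite add1n !word_val_alt_odd vuV expVgn -addnn expgnDr.
    by move=> braid; rewrite -mulgA braid mulVKg.
  rewrite add0n; case: (n./2) => // k _; rewrite !word_val_alt_even vuV => braid.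
  have -> : (gen u * gen v) ^+ (k.+1.*2).-1 =
      (gen u * gen v) ^+ k.+1 * (gen u * gen v) ^+ k.+1 * (gen u * gen v)^-1.
    by rewrite -expgnDr addnn doubleS /= expgSr mulgK.
  by rewrite {2}braid expVgn mulgV mul1g -vuV -mulgA u2 mulg1.
have le_in : i <= n.-1 by rewrite -ltnS prednK.
rewrite !alt_reflection_involution // vuV expVgn.
apply: (mulgI ((gen u * gen v) ^+ (n.-1 - i))).
by rewrite mulVKg mulgA -expgnDr subnK.
Qed.

End WordCocycle.

(** * Existence of the crossed homomorphism for Dyer groups *)

Section DyerGroup.
Local Open Scope group_scope.
Context {D : groupType} (Gamma : dyer_graph) (phi : dyer_group Gamma -> D).
Hypotheses (phiM : {morph phi : x y / x * y}) (phi_bij : bijective phi).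

Let gen (v : Gamma) : D := phi (dyer_gen v).
Let cls (w : gword Gamma) : dyer_group Gamma := pres_class (@dyer_rel Gamma) w.

Lemma pres_class_cat w1 w2 : cls (w1 ++ w2) = cls w1 * cls w2.
Proof.
by apply/pres_classP/PresSym; apply: PresCat; exact: repr_pres_class.
Qed.

Lemma morph_pres_class w : phi (cls w) = word_val gen w.
Proof.
have phi1 : phi 1 = 1.
  by apply: (mulgI (phi 1)); rewrite -phiM !mulg1.
have phiV x : phi x^-1 = (phi x)^-1.
  by apply/esym/mulg1_eq; rewrite -phiM mulgV.
elim: w => [|[v b] w IHw] //=; rewrite -cat1s pres_class_cat phiM IHw.
congr (_ * _); rewrite /letter_val /=; case: b => //.
rewrite /gen -phiV; congr phi; apply/esym/mulg1_eq.
rewrite -pres_class_cat; apply/pres_classP; exact: PresCancel.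
Qed.

Lemma word_val_surj g : exists w, word_val gen w = g.
Proof.
have [psi phiK psiK] := phi_bij.
by exists (repr (psi g)); rewrite -morph_pres_class /cls pres_class_repr psiK.
Qed.

Lemma pres_eq_word_val w1 w2 :
  word_val gen w1 = word_val gen w2 -> pres_eq (@dyer_rel Gamma) w1 w2.
Proof.
by rewrite -!morph_pres_class => /(bij_inj phi_bij)/pres_classP.
Qed.

Lemma dyer_rel_word_val w1 w2 :
  dyer_rel w1 w2 -> word_val gen w1 = word_val gen w2.
Proof.
by move=> /PresRel/pres_classP eq_cls; rewrite -!morph_pres_class /cls eq_cls.
Qed.

Lemma dyer_gen_involution v : vlab v = Some 2 -> gen v * gen v = 1.
Proof. by move=> /DyerPower/dyer_rel_word_val; rewrite word_val_power. Qed.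

Lemma label_eq2 (l : label) : label_ge 2 l -> ~~ label_ge 3 l -> l = Some 2.
Proof. by case: l => [[|[|[]]]|]. Qed.

Lemma dyer_rel_word_cocycle w1 w2 :
  dyer_rel w1 w2 -> word_cocycle gen w1 = word_cocycle gen w2.
Proof.
case=> [v n vn|u v n neq_uv].
  apply: funext => t; rewrite word_cocycle_power -word_val_power.
  by rewrite (dyer_rel_word_val _ _ (DyerPower vn)) /=; case: ifP.
rewrite /mlab; have [adj_uv uvn|not_adj [<-]] := boolP (adj u v).
  (* A finite edge label excludes vertex labels at least 3, so both generators are involutions and
     the dihedral computation applies. *)
  have v2 : vlab v = Some 2.
    apply: label_eq2; first exact: vlab_ge2.
    by apply/negP => /(elab_infty adj_uv); rewrite uvn.
  have u2 : vlab u = Some 2.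
    apply: label_eq2; first exact: vlab_ge2.
    apply/negP; rewrite adj_sym in adj_uv => /(elab_infty adj_uv).
    by rewrite -elab_sym ?uvn // adj_sym.
  have n_gt0 : 0 < n by have := elab_gt2 adj_uv; rewrite uvn; case: n {uvn}.
  apply: word_cocycle_braid; apply: alt_reflection_braid => //.
  - exact: dyer_gen_involution.
  - exact: dyer_gen_involution.
  - apply/dyer_rel_word_val/DyerBraid => //.
    by rewrite /mlab adj_uv.
have gens_commute : gen u * gen v = gen v * gen u.
  have /DyerBraid : mlab u v = Some 2 by rewrite /mlab (negbTE not_adj).
  by move=> /(_ neq_uv)/dyer_rel_word_val; rewrite /= /letter_val /= !mulg1.
(* The generators commute, so conjugation is trivial: the sequences are [u, v] and [v, u], whatever
   the vertex labels. *)
apply: word_cocycle_braid => -[|[|//]] _; rewrite /alt_reflection /=.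
  by rewrite /letter_val /= !mulg1 invg1 mul1g mulg1 -gens_commute mulgK.
by rewrite /letter_val /= !mulg1 invg1 mul1g mulg1 gens_commute mulgK.
Qed.

(** [N g] is read off a chosen word for [g]. The choice is immaterial: injectivity of [phi] makes
    words of equal value congruent, and [word_cocycle] respects the congruence. *)
Lemma dyer_wall_cocycle :
  exists N, wall_cocycle (range gen) N.
Proof.
have [word wordK] := choice word_val_surj.
pose N g := word_cocycle gen (word g).
have NE w g : word_val gen w = g -> N g = word_cocycle gen w.
  move=> gw.
  apply: (word_cocycle_pres _ _ _ _ dyer_rel_word_val dyer_rel_word_cocycle).
  by apply: pres_eq_word_val; rewrite wordK.
exists N; split=> [g h t|_ [v _ <-] t].
  have [[w gw] [w' hw']] := (word_val_surj g, word_val_surj h).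
  rewrite (NE (w ++ w')) ?word_val_cat ?gw ?hw' // word_cocycle_cat.
  by rewrite gw -(NE _ _ gw) -(NE _ _ hw').
rewrite (NE [:: (v, false)]) /= /letter_val /= ?mulg1 //.
by rewrite mulgV mulg1.
Qed.

End DyerGroup.

Theorem theoremE (D : groupType) (X : set D) (hX : dyer_system X)
    (I : Type) (P : I -> set D) (hP : forall i : I, parabolic X (P i)) :
  parabolic X (\bigcap_i P i).
Proof.
have [genX [Gamma [phi [phiM phi_bij [funX _ surjX]]]]] := hX.
have XE : X = range (fun v : Gamma => phi (dyer_gen v)).
  apply/seteqP; split; first exact: surjX.
  by move=> _ [v _ <-]; exact: funX.
have [N hN] := dyer_wall_cocycle Gamma phi phiM phi_bij.
rewrite -XE in hN.
exact: (parabolic_bigcap X N hN Gamma _ _ _ genX surjX hP).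
Qed.
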